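(* Let $p>2$ be a prime number. Then $$(p-1)-|R_{(p,p)}|\ge \frac{p-1}{2}-1.$$
   Context: $K$ is a field. For integers $a,b\ge2$, let $R_{(a,b)}$ be the set of all reduction numbers $r(I)$ of ideals $I=(x^a,y^b,x^cy^d)\subset K[x,y]$, where $c,d$ are integers with $0<c<a$, $0<d<b$ and $bc+ad\ge ab$. Here, with $J=(x^a,y^b)$, the reduction number $r(I)$ is the smallest integer $r\ge0$ with $I^{r+1}=JI^r$ (such $r$ exists). $|R_{(a,b)}|$ denotes cardinality. *)

(* Defs.v *)
From mathcomp Require Import all_boot all_order all_algebra.
From mathcomp Require Import finmap boolp classical_sets cardinality.
From mathcomp Require Import mpoly.

Set Implicit Arguments.
Unset Strict Implicit.
Unset Printing Implicit Defensive.

Import GRing.Theory.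
Local Open Scope ring_scope.
Local Open Scope classical_set_scope.

Section Ideals.
Variable R : comNzRingType.

Definition ideal_gen (S : set R) : set R :=
  [set f | exists n (a g : 'I_n -> R),
     (forall i, S (g i)) /\ f = \sum_(i < n) a i * g i].

Definition ideal_mul (I J : set R) : set R :=
  ideal_gen [set f * g | f in I & g in J].

Fixpoint ideal_exp (I : set R) (n : nat) : set R :=
  if n is m.+1 then ideal_mul I (ideal_exp I m) else setT.

Definition is_reduction_number (J I : set R) (r : nat) : Prop :=
  ideal_exp I r.+1 = ideal_mul J (ideal_exp I r) /\
  forall s, ideal_exp I s.+1 = ideal_mul J (ideal_exp I s) -> (r <= s)%N.

End Ideals.

Section ReductionNumbers.
Variable K : fieldType.

Notation x := ('X_(0 : 'I_2) : {mpoly K[2]}).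
Notation y := ('X_(1 : 'I_2) : {mpoly K[2]}).

Definition ideal_J (a b : nat) : set {mpoly K[2]} :=
  ideal_gen [set x ^+ a; y ^+ b].

Definition ideal_I (a b c d : nat) : set {mpoly K[2]} :=
  ideal_gen [set x ^+ a; y ^+ b; x ^+ c * y ^+ d].

Definition reduction_numbers (a b : nat) : set nat :=
  [set r | exists c d : nat,
     [/\ (0 < c < a)%N, (0 < d < b)%N, (a * b <= b * c + a * d)%N &
         is_reduction_number (ideal_J a b) (ideal_I a b c d) r]].

(* The cardinal of the fset_set of an infinite set is a junk value; this lemma
   rules that case out. *)
Lemma finite_reduction_numbers (a b : nat) :
  finite_set (reduction_numbers a b).
Proof.
pose f (cd : nat * nat) : nat :=
  xget 0%N [set r | is_reduction_number (ideal_J a b) (ideal_I a b cd.1 cd.2) r].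
apply: (@sub_finite_set _ _ (f @` (`I_a `*` `I_b))); last first.
  by apply: finite_image; apply: finite_setX; exact: finite_II.
move=> r [c [d [/andP[_ ca] /andP[_ db] _ hr]]].
exists (c, d); first by split.
rewrite /f; case: xgetP => [s _ hs|/(_ r)//].
by apply/eqP; rewrite eqn_leq (hs.2 _ hr.1) (hr.2 _ hs.1).
Qed.

End ReductionNumbers.

(* Main.v *)
Require Import Defs.
From mathcomp Require Import all_boot all_order all_algebra.
From mathcomp Require Import finmap boolp classical_sets cardinality.
From mathcomp Require Import mpoly zify lra.

(** All ideals involved are monomial, and the equality I^(r+1) = J I^r says that
    every product of r+1 generators of I lies in J I^r.  This is clear as soon
    as x^a or y^b occurs in the product, so only (x^c y^d)^(r+1) matters.  A
    monomial lies in a monomial ideal exactly when one of the generators divides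
    it ([mem_monomial_ideal]); after cancelling the common powers of x^c y^d,
    the condition becomes: for some n with 1 <= n <= r+1, the monomial
    (x^c y^d)^n is divisible by some x^(a i) y^(b j) with i + j = n
    ([reduction_criterion]).  Hence r(I) + 1 is the least such n.

    Let now a = b = p be an odd prime, so that c + d >= p.

    If c + d = p, both sides of the divisibility have degree p n, so that
    c n = p i; as p does not divide c, it divides n.  Thus r(I) = p - 1
    ([reducible_power_on_diagonal]).

    If c + d > p, some n <= (p+1)/2 works ([reducible_power_above_diagonal]).
    Lowering d only makes the condition harder, so take d = p - e with
    e = c - 1.  One looks for n > 0 such that the residue of c n modulo p is at
    most n; the residue of d n is then the difference, because (c + d) n is
    congruent to n.  Let 0 < q < p be the solution of q e = -1 modulo p.  If n is
    congruent to q t, then d n is congruent to t.  For q <= (p+1)/2, take t = 1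
    and n = q.  Otherwise put j = p - q, so that n = p - j t decreases as t
    grows; go on as long as n >= t, that is up to t = floor(p / (j+1)).

    Since n = 1 is impossible, r(I) is either p - 1 or one of 1, ..., (p-1)/2,
    which leaves at most (p+1)/2 values ([card_reduction_numbers_prime]). *)

Import GRing.Theory Num.Theory.
Local Open Scope ring_scope.

(** * Ideals given by generators *)

Section GeneratedIdeals.
Local Open Scope classical_set_scope.
Context {R : comNzRingType}.
Implicit Types S T I : set R.

Definition is_ideal I : Prop :=
  [/\ I 0, forall f g, I f -> I g -> I (f + g) & forall a f, I f -> I (a * f)].

(** The sums allowed in [ideal_gen] may be iterated; the closure properties of
    an ideal are the cases of length 0, 1 and 2. *)
Lemma ideal_gen_sum S n (a g : 'I_n -> R) :
  (forall i, ideal_gen S (g i)) -> ideal_gen S (\sum_(i < n) a i * g i).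
Proof.
move=> hg; apply: (big_ind (ideal_gen S)).
- by exists 0%N, (fun _ => 0), (fun _ => 0); split; [case|rewrite big_ord0].
- move=> _ _ [n1 [a1 [g1 [h1 ->]]]] [n2 [a2 [g2 [h2 ->]]]].
  exists (n1 + n2)%N, (fun i => match split i with inl j => a1 j | inr j => a2 j end),
     (fun i => match split i with inl j => g1 j | inr j => g2 j end).
  split; first by move=> i; case: (split i).
  rewrite big_split_ord; congr (_ + _); apply: eq_bigr => i _.
    by rewrite (unsplitK (inl i)).
  by rewrite (unsplitK (inr i)).
- move=> i _; have [m [b [h [hS ->]]]] := hg i.
  exists m, (fun j => a i * b j), h; split=> //.
  by rewrite mulr_sumr; apply: eq_bigr => j _; rewrite mulrA.
Qed.

Lemma sub_ideal_gen S : S `<=` ideal_gen S.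
Proof.
move=> f Sf; exists 1%N, (fun=> 1), (fun=> f).
by split=> //; rewrite big_ord1 mul1r.
Qed.

Lemma ideal_gen_is_ideal S : is_ideal (ideal_gen S).
Proof.
split.
- have := @ideal_gen_sum S 0%N (fun=> 0) (fun=> 0).
  by rewrite big_ord0; apply; case.
- move=> f g Sf Sg.
  have := @ideal_gen_sum S 2%N (fun=> 1) (fun i => if i == ord0 then f else g).
  by rewrite !big_ord_recl big_ord0 /= !mul1r addr0; apply=> i; case: ifP.
- move=> a f Sf; have := @ideal_gen_sum S 1%N (fun=> a) (fun=> f).
  by rewrite big_ord1; apply.
Qed.

Lemma ideal_gen_min S I : is_ideal I -> S `<=` I -> ideal_gen S `<=` I.
Proof.
move=> [I0 ID IM] SI _ [n [a [g [Sg ->]]]].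
by apply: (big_ind I) => // i _; apply/IM/SI/Sg.
Qed.

(** One factor is treated at a time: for fixed [g], the [f] with [f * g] in a
    given ideal form an ideal, so it suffices to look at generators. *)
Lemma ideal_mul_gen S T :
  ideal_mul (ideal_gen S) (ideal_gen T) = ideal_gen [set f * g | f in S & g in T].
Proof.
have [U0 UD UM] := ideal_gen_is_ideal [set f * g | f in S & g in T].
apply/seteqP; split; apply: ideal_gen_min; try exact: ideal_gen_is_ideal.
  move=> _ [f Sf [g Tg <-]]; move: f Sf.
  apply: ideal_gen_min.
    split=> [|f f' hf hf'|a f hf]; rewrite ?mul0r ?mulrDl -?mulrA //.
      exact: UD.
    exact: UM.
  move=> f Sf; move: g Tg; apply: ideal_gen_min.
    split=> [|g g' hg hg'|a g hg]; rewrite ?mulr0 ?mulrDr //.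
      exact: UD.
    by rewrite mulrCA; exact: UM.
  by move=> g Tg; apply: sub_ideal_gen; exists f => //; exists g.
move=> _ [f Sf [g Tg <-]]; apply: sub_ideal_gen.
by exists f; [exact: sub_ideal_gen|exists g => //; exact: sub_ideal_gen].
Qed.

Lemma ideal_gen1 : ideal_gen [set 1 : R] = setT.
Proof.
apply/seteqP; split=> // f _; have [_ _ mulI] := ideal_gen_is_ideal [set 1 : R].
by rewrite -[f]mulr1; apply: mulI; exact: sub_ideal_gen.
Qed.

End GeneratedIdeals.

(** * Monomial ideals *)

Section MonomialIdeals.
Local Open Scope classical_set_scope.
Context {n : nat} {R : comNzRingType}.
Implicit Types E F : set 'X_{1..n}.

Definition monomial_ideal E : set {mpoly R[n]} :=
  ideal_gen [set 'X_[m] | m in E].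

(** The polynomials all of whose monomials are divisible by one from [E] form
    an ideal containing the generators, so [monomial_ideal E] has no others. *)
Lemma mem_monomial_ideal E m :
  monomial_ideal E 'X_[m] <-> exists2 e, E e & (e <= m)%MM.
Proof.
split=> [Em|[e Ee le_em]]; last first.
  have [_ _ mulI] := @ideal_gen_is_ideal {mpoly R[n]} [set 'X_[m] | m in E].
  by rewrite -(submK le_em) mpolyXD; apply/mulI/sub_ideal_gen; exists e.
suff /(_ _ Em m) : monomial_ideal E `<=`
    [set f | forall u, u \in msupp f -> exists2 e, E e & (e <= u)%MM].
  by apply; rewrite msuppX mem_head.
apply: ideal_gen_min => [|_ [e Ee <-] u]; last first.
  by move/mem_msuppXP <-; exists e => //; exact: lepm_refl.
split=> [u|f g hf hg u /msuppD_le|a f hf u /msuppM_le /allpairsP[[v w] /= [_ wf ->]]].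
- by rewrite msupp0.
- by rewrite mem_cat => /orP[/hf|/hg].
- have [e Ee le_ew] := hf _ wf; exists e => //.
  exact: (lepm_trans le_ew (lem_addl _ _)).
Qed.

Lemma monomial_ideal_sub E F :
  (forall e, E e -> exists2 f, F f & (f <= e)%MM) ->
  monomial_ideal E `<=` monomial_ideal F.
Proof.
move=> EF; apply: ideal_gen_min; first exact: ideal_gen_is_ideal.
by move=> _ [e Ee <-]; apply/mem_monomial_ideal/EF.
Qed.

Lemma monomial_ideal_mul E F :
  ideal_mul (monomial_ideal E) (monomial_ideal F)
  = monomial_ideal [set (e + f)%MM | e in E & f in F].
Proof.
rewrite ideal_mul_gen; congr ideal_gen; apply/seteqP; split.
  move=> _ [_ [e Ee <-] [_ [f Ff <-] <-]].
  by exists (e + f)%MM; [exists e => //; exists f|rewrite mpolyXD].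
move=> _ [_ [e Ee [f Ff <-]] <-].
exists 'X_[e]; first by exists e.
by exists 'X_[f]; [exists f|rewrite mpolyXD].
Qed.

Lemma monomial_ideal0 : monomial_ideal [set 0%MM] = setT.
Proof. by rewrite /monomial_ideal image_set1 mpolyX0 ideal_gen1. Qed.

End MonomialIdeals.

(** * Reduction numbers as a minimum over integers *)

Section ReductionCriterion.
Local Open Scope classical_set_scope.
Variables (K : fieldType) (a b c d : nat).

Definition mon (u v : nat) : 'X_{1..2} := (U_(0%R) *+ u + U_(1%R) *+ v)%MM.

Lemma monE u v i : mon u v i = if i == 0 then u else v.
Proof.
rewrite /mon mnmDE !mulmnE !mnm1E.
by case: i => [[|[|//]] hi] /=; rewrite ?mul1n ?mul0n ?addn0 ?add0n.
Qed.

Lemma mpolyX_mon u v :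
  'X_[mon u v] = 'X_(0 : 'I_2) ^+ u * 'X_(1 : 'I_2) ^+ v :> {mpoly K[2]}.
Proof. by rewrite /mon mpolyXD !mpolyXn. Qed.

Lemma mon_le u v u' v' :
  (mon u v <= mon u' v')%MM <-> (u <= u')%N /\ (v <= v')%N.
Proof.
split=> [/mnm_lepP h|[hu hv]].
  by have := h 0; have := h 1; rewrite !monE.
by apply/mnm_lepP => i; rewrite !monE; case: ifP.
Qed.

Lemma monD u v u' v' : (mon u v + mon u' v')%MM = mon (u + u') (v + v').
Proof. by apply/mnmP => i; rewrite mnmDE !monE; case: ifP. Qed.

Lemma mon0 : mon 0 0 = 0%MM.
Proof. by apply/mnmP => i; rewrite monE mnm0E; case: ifP. Qed.

(** The exponent of (x^a)^i (y^b)^j (x^c y^d)^k. *)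
Definition power_exp (i j k : nat) : 'X_{1..2} :=
  mon (a * i + c * k) (b * j + d * k).

Definition powers_I (n : nat) : set 'X_{1..2} :=
  [set e | exists i j k, (i + j + k = n)%N /\ e = power_exp i j k].

Definition powers_JI (n : nat) : set 'X_{1..2} :=
  [set e | exists i j k,
     [/\ (i + j + k = n)%N, (0 < i + j)%N & e = power_exp i j k]].

Lemma ideal_J_monomial :
  @ideal_J K a b = monomial_ideal [set mon a 0; mon 0 b].
Proof.
rewrite /ideal_J /monomial_ideal; congr ideal_gen.
by rewrite image_setU !image_set1 !mpolyX_mon !expr0 mulr1 mul1r.
Qed.

Lemma ideal_I_monomial :
  @ideal_I K a b c d = monomial_ideal [set mon a 0; mon 0 b; mon c d].
Proof.
rewrite /ideal_I /monomial_ideal; congr ideal_gen.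
by rewrite !image_setU !image_set1 !mpolyX_mon !expr0 mulr1 mul1r.
Qed.

Lemma ideal_exp_monomial n :
  ideal_exp (@ideal_I K a b c d) n = monomial_ideal (powers_I n).
Proof.
elim: n => [|n IHn] /=.
  rewrite -monomial_ideal0; congr monomial_ideal; apply/seteqP; split.
    by move=> _ ->; exists 0%N, 0%N, 0%N; rewrite /power_exp !muln0 mon0.
  move=> _ [[|i] [[|j] [[|k] [//= _ ->]]]].
  by rewrite /power_exp !muln0 mon0.
rewrite IHn ideal_I_monomial monomial_ideal_mul; congr monomial_ideal.
apply/seteqP; split.
  move=> _ [e he [_ [i [j [k [<- ->]]]] <-]].
  case: he => [[]|] ->; rewrite /power_exp monD.
  - by exists i.+1, j, k; split; [lia|congr mon; lia].
  - by exists i, j.+1, k; split; [lia|congr mon; lia].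
  - by exists i, j, k.+1; split; [lia|congr mon; lia].
move=> _ [[|i] [j [k [hn ->]]]]; last first.
  exists (mon a 0); first by left; left.
  exists (power_exp i j k); first by exists i, j, k; split=> //; lia.
  by rewrite monD; congr mon; lia.
case: j hn => [|j] hn; last first.
  exists (mon 0 b); first by left; right.
  exists (power_exp 0 j k); first by exists 0%N, j, k; split=> //; lia.
  by rewrite monD; congr mon; lia.
exists (mon c d); first by right.
exists (power_exp 0 0 n); first by exists 0%N, 0%N, n.
have -> : k = n.+1 by lia.
by rewrite monD; congr mon; lia.
Qed.

Lemma ideal_J_mul_exp n :
  ideal_mul (@ideal_J K a b) (ideal_exp (@ideal_I K a b c d) n)
  = monomial_ideal (powers_JI n.+1).
Proof.
rewrite ideal_exp_monomial ideal_J_monomial monomial_ideal_mul.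
congr monomial_ideal; apply/seteqP; split.
  move=> _ [e he [_ [i [j [k [<- ->]]]] <-]].
  case: he => ->; rewrite /power_exp monD.
  - by exists i.+1, j, k; split; [lia|lia|congr mon; lia].
  - by exists i, j.+1, k; split; [lia|lia|congr mon; lia].
move=> _ [[|i] [j [k [hn ij0 ->]]]]; last first.
  exists (mon a 0); first by left.
  exists (power_exp i j k); first by exists i, j, k; split=> //; lia.
  by rewrite monD; congr mon; lia.
case: j hn ij0 => [//|j] hn _.
exists (mon 0 b); first by right.
exists (power_exp 0 j k); first by exists 0%N, j, k; split=> //; lia.
by rewrite monD; congr mon; lia.
Qed.

(** Divisibility of (x^c y^d)^n by one of the natural generators of J^n. *)
Definition reducible_power (n : nat) : Prop :=
  exists i j, [/\ (i + j = n)%N, (a * i <= c * n)%N & (b * j <= d * n)%N].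

(** A generator of J I^r dividing (x^c y^d)^(r+1) is x^(a i) y^(b j) times
    (x^c y^d)^k with i + j + k = r + 1, and the last factor can be cancelled.
    Conversely, multiplying by a power of x^c y^d passes from n to r + 1. *)
Lemma reduction_criterion r :
  ideal_exp (@ideal_I K a b c d) r.+1
    = ideal_mul (@ideal_J K a b) (ideal_exp (@ideal_I K a b c d) r)
  <-> exists2 n, (0 < n <= r.+1)%N & reducible_power n.
Proof.
rewrite ideal_J_mul_exp ideal_exp_monomial; split.
  move=> eqIJ.
  have : monomial_ideal (R := K) (powers_I r.+1) 'X_[power_exp 0 0 r.+1].
    by apply: sub_ideal_gen; exists (power_exp 0 0 r.+1) => //; exists 0%N, 0%N, r.+1.
  rewrite eqIJ => /mem_monomial_ideal [_ [i [j [k [hn ij0 ->]]]]].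
  rewrite /power_exp mon_le => -[hi hj].
  rewrite -{}hn in hi hj *.
  by exists (i + j)%N; [lia|exists i, j; split=> //; lia].
move=> [n /andP[n0 nr] [i [j [ijn hi hj]]]].
apply/seteqP; split; apply: monomial_ideal_sub => e; last first.
  move=> [i' [j' [k [hk _ ->]]]]; exists (power_exp i' j' k); last exact: lepm_refl.
  by exists i', j', k.
move=> [i' [j' [k [hk ->]]]]; have [ij0|ij0] := posnP (i' + j').
  have [m rE] : exists m, r.+1 = (n + m)%N by exists (r.+1 - n)%N; lia.
  have [-> -> ->] : [/\ i' = 0, j' = 0 & k = n + m]%N by split; lia.
  exists (power_exp i j m); first by exists i, j, m; split=> //; lia.
  by rewrite /power_exp mon_le; split; lia.
exists (power_exp i' j' k); last exact: lepm_refl.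
by exists i', j', k.
Qed.

End ReductionCriterion.

(** * The equigenerated case of prime degree *)

Section PrimeDegree.
Local Open Scope classical_set_scope.
Variables (K : fieldType) (p : nat).
Hypotheses (hp : prime p) (hp2 : (2 < p)%N).

(** Equality c + d = p leaves no slack in the two inequalities of
    [reducible_power], so c * n is a multiple of p. *)
Lemma reducible_power_on_diagonal c d n : (0 < c < p)%N -> (c + d = p)%N ->
  (0 < n)%N -> reducible_power p p c d n -> (p <= n)%N.
Proof.
move=> /andP[c0 cp] cdp n0 [i [j [ijn hi hj]]].
have cn : (c * n = i * p)%N.
  have : (p * i + p * j = c * n + d * n)%N by rewrite -mulnDr -mulnDl ijn cdp.
  by lia.
have : (p %| c * n)%N by rewrite cn dvdn_mull.
rewrite Euclid_dvdM // => /orP[] /dvdn_leq; lia.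
Qed.

(** The line c + d = p + 1 is the worst case.  There the pairs
    (c n mod p, d n mod p) run over the nonzero points of a lattice, and a point
    of small coordinate sum is among the multiples of the one whose second
    coordinate is 1. *)
Lemma reducible_power_above_diagonal c d : (0 < c < p)%N -> (0 < d < p)%N ->
  (p < c + d)%N ->
  exists2 n, (0 < n)%N && (n.*2 <= p.+1)%N & reducible_power p p c d n.
Proof.
move=> /andP[c0 cp] /andP[d0 dp] pcd.
have oddp : odd p by case: (even_prime hp) hp2 => [->|].
have [e ec] : exists e, c = e.+1 by exists c.-1; lia.
have e0 : (0 < e)%N by lia.
(* It is enough to treat the smallest possible d, which is p - e. *)
suff [n hn [i [j [ijn hi hj]]]] :
    exists2 n, (0 < n)%N && (n.*2 <= p.+1)%N & reducible_power p p c (p - e) n.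
  exists n => //; exists i, j; split=> //; apply: leq_trans hj _.
  by rewrite leq_mul2r; apply/orP; right; lia.
have cop : coprime p e by rewrite prime_coprime // gtnNdvd //; lia.
have [q qp] := @Bezoutl p e (prime_gt0 hp).
rewrite (eqP (_ : gcdn p e == 1%N)); last exact: cop.
move=> /dvdnP[u hu].
have q0 : (0 < q)%N by case: q hu {qp} => //; case: u => [|u]; lia.
have [q_small|q_large] := leqP q.*2 p.+1.
  (* c * q = p * u + (q - 1) and (p - e) * q = p * (q - u) + 1. *)
  exists q; first by rewrite q0.
  have [g pE] : exists g, p = (e + g.+1)%N by exists (p - e).-1; lia.
  have uq : (u <= q)%N.
    rewrite -(leq_pmul2r (prime_gt0 hp)) -hu pE mulnDr mulnS.
    by lia.
  have [w qE] : exists w, q = (u + w)%N by exists (q - u)%N; lia.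
  exists u, w; split; [by []|by rewrite ec; lia|].
  by rewrite mulnBl [(e * q)%N]mulnC qE in hu *; lia.
(* Now -j is congruent to q, hence j is an inverse of e modulo p. *)
have [j pE] : exists j, p = (q + j)%N by exists (p - q)%N; lia.
have [v hv] : exists v, (j * e = 1 + v * p)%N.
  have : (j * e + u * p = 1 + e * p)%N by rewrite -hu [in RHS]pE; lia.
  have [le_ue|lt_eu] := leqP u e; last first.
    have [w uE] : exists w, u = (e + w.+1)%N by exists (u - e).-1; lia.
    by rewrite uE; lia.
  have [w eE] : exists w, e = (u + w)%N by exists (e - u)%N; lia.
  by move=> h; exists w; move: h; rewrite [in RHS]eE; lia.
(* The integer n = p - j * t is congruent to q * t; for t the quotient of p by
   j + 1 it equals t + s, where s is the remainder. *)
have := divn_eq p j.+1; have := ltn_pmod p (ltn0Sn j).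
have t0 : (0 < p %/ j.+1)%N by rewrite divn_gt0 //; lia.
move: t0; move: (p %/ j.+1)%N (p %% j.+1)%N => t s t0 sj pt.
have pn : (t + s + j * t = p)%N by lia.
have tve : (p * (t * v) + t = j * t * e)%N by rewrite mulnAC hv; lia.
have pe : ((t + s) * e + j * t * e = p * e)%N by rewrite -mulnDl pn.
have [i eE] : exists i, e = (i + t * v)%N.
  exists (e - t * v)%N; rewrite subnK // -(leq_pmul2l (prime_gt0 hp)); lia.
have pi : (p * i = (t + s) * e + t)%N.
  by rewrite [in (p * e)%N]eE mulnDr in pe; lia.
exists (t + s)%N.
  (* (t - 1) * (j - 1) >= 0; this and s <= j give 2 * (t + s) <= p + 1. *)
  have tj : (t + j <= t * j + 1)%N.
    have j0 : (0 < j)%N by lia.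
    have [t' ->] : exists t', t = t'.+1 by exists t.-1; lia.
    have [j' ->] : exists j', j = j'.+1 by exists j.-1; lia.
    lia.
  by lia.
have [g pg] : exists g, p = (e + g.+1)%N by exists (p - e).-1; lia.
have le_in : (i <= t + s)%N.
  by rewrite -(leq_pmul2l (prime_gt0 hp)) pi [in X in (_ <= X)%N]pg; lia.
have [w nE] : exists w, (t + s = i + w)%N by exists (t + s - i)%N; lia.
exists i, w; split; [by []|by rewrite pi ec; lia|].
have : (p * i + p * w = p * (t + s))%N by rewrite nE mulnDr.
by rewrite pi mulnBl [(p * (t + s))%N]mulnC [in RHS]mulnC [(e * _)%N]mulnC; lia.
Qed.

Lemma reduction_numbers_prime r : reduction_numbers K p p r ->
  r = p.-1 \/ (0 < r <= p.-1./2)%N.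
Proof.
move=> [c [d [cp dp]]].
rewrite -mulnDr leq_pmul2l ?(prime_gt0 hp) // => pcd.
move=> [/reduction_criterion [n /andP[n0 nr] hn] rmin].
have upper m : (0 < m)%N -> reducible_power p p c d m -> (r < m)%N.
  case: m => // m _ hm; rewrite ltnS; apply: rmin; apply/reduction_criterion.
  by exists m.+1 => //=.
have [cdp|pcd'] := leqP (c + d) p.
  left; have cdE : (c + d = p)%N by lia.
  have := reducible_power_on_diagonal c d n cp cdE n0 hn.
  have : (r < p)%N.
    by apply: upper; [exact: prime_gt0|exists c, d; split=> //; rewrite mulnC].
  by lia.
right; have [m /andP[m0 mp] hm] := reducible_power_above_diagonal c d cp dp pcd'.
have := upper m m0 hm.
have n1 : n <> 1%N.
  by move=> n1; move: hn; rewrite n1 => -[[|i] [[|j] []]]; lia.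
have := upper n n0 hn; lia.
Qed.

Lemma card_reduction_numbers_prime :
  (#|` fset_set (reduction_numbers K p p)| <= p.-1./2.+1)%N.
Proof.
have -> : p.-1./2.+1 = size (p.-1 :: iota 1 p.-1./2) by rewrite /= size_iota.
apply: uniq_leq_size; first exact: fset_uniq.
move=> r; rewrite in_fset_set; last exact: finite_reduction_numbers.
rewrite inE => /reduction_numbers_prime hr.
rewrite in_cons mem_iota; apply/orP.
by case: hr => [->|hr]; [left|right; lia].
Qed.

End PrimeDegree.

Theorem proposition4p5 (K : fieldType) (p : nat) (hp : prime p) (hp2 : (2 < p)%N) :
  (p%:R - 1) - #|` fset_set (reduction_numbers K p p)|%:R
    >= (p%:R - 1) / 2%:R - 1 :> rat.
Proof.
have card_le := card_reduction_numbers_prime K p hp hp2.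
have : (2 * #|` fset_set (reduction_numbers K p p)| <= p.+1)%N by lia.
rewrite -(ler_nat rat) natrM -[p.+1]addn1 natrD => h.
lra.
Qed.
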